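(* Let $q\ge1$, let $\{a_n\}_{n\ge1}$, $\{b_n\}_{n\ge1}$ be real $q$-periodic sequences with $a_n>0$, and let $J_0$ be the Jacobi operator with coefficients $a_n,b_n$, with spectral bands $[c_k,d_k]$ and quasimomentum $k(E)$. Suppose $\{E_j\}_{j=1}^\infty\subset\bigcup_k(c_k,d_k)$ is such that the quasimomenta $\{k(E_j)\}_{j\ge1}$ are pairwise different, and suppose $k(E_i)+k(E_j)\ne\pi$ for any $i,j$ (including $i=j$). Let $h:\mathbb{Z}_{\ge0}\to(0,\infty)$ be any function with $\lim_{n\to\infty}h(n)=\infty$. Let $a'_n=0$ for all $n$. Then for any given $\{\theta_j\}_{j=1}^\infty\subset[0,\pi]$ there exists a real sequence $(b'_n)$ such that $$|b'_n|\le\frac{h(n)}{1+n}\quad\text{for all }n,$$ and for every $j\ge1$ the equation $Ju=E_ju$, where $(Ju)(n)=a_{n+1}u(n+1)+a_nu(n-1)+(b_{n+1}+b'_{n+1})u(n)$, has a (non-trivial) $\ell^2(\mathbb{Z}_{\ge0})$ solution with boundary condition $$\frac{u(1)}{u(0)}=\tan\theta_j.$$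
   Context: The unperturbed operator is $(J_0u)(n)=a_{n+1}u(n+1)+a_nu(n-1)+b_{n+1}u(n)$. A solution of $Ju=Eu$ on $\mathbb{Z}_{\ge0}$ is a sequence $(u(n))_{n\ge0}$ satisfying $(Ju)(n)=Eu(n)$ for all $n\ge1$, so that it is determined by $(u(0),u(1))$. We have $\sigma_{\rm ac}(J_0)=\sigma_{\rm ess}(J_0)=\bigcup_k[c_k,d_k]$. For $E\in(c_k,d_k)$ there is a Floquet solution $\varphi(n)=p(n)e^{i\frac{k(E)}{q}n}$ of $J_0\varphi=E\varphi$, where $p$ is $q$-periodic and $k(E)\in(0,\pi)$ is the quasimomentum, so $\varphi(n+q)=e^{ik(E)}\varphi(n)$. The open intervals $(c_k,d_k)$ are the connected components of the set of real $E$ for which the discriminant (trace of the transfer matrix over one period, equal to $2\cos k(E)$ there) has absolute value less than $2$. The boundary condition $u(1)/u(0)=\tan\theta_j$ with $\theta_j=\pi/2$ means $u(0)=0$. *)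

(* Defs.v *)
From HB Require Import structures.
From mathcomp Require Import all_boot all_order all_algebra.
From mathcomp Require Import all_classical all_reals all_analysis.
From mathcomp Require Import complex.

Set Implicit Arguments.
Unset Strict Implicit.
Unset Printing Implicit Defensive.

Import Order.TTheory GRing.Theory Num.Theory.
Import numFieldNormedType.Exports.

Local Open Scope classical_set_scope.
Local Open Scope ring_scope.

(* Coefficient sequences are indexed by n >= 1; the value at index 0 of a
   sequence [nat -> _] standing for such a family is never used. *)

Definition periodic_seq (T : Type) (q : nat) (c : nat -> T) : Prop :=
  forall n : nat, (1 <= n)%N -> c (n + q)%N = c n.

(* Used for n >= 1 only, so that [n.-1] is the honest predecessor. *)
Definition jacobi (K : pzRingType) (a b u : nat -> K) (n : nat) : K :=
  a n.+1 * u n.+1 + a n * u n.-1 + b n.+1 * u n.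

Definition solves (K : pzRingType) (a b : nat -> K) (E : K) (u : nat -> K)
    : Prop :=
  forall n : nat, (1 <= n)%N -> jacobi a b u n = E * u n.

Definition nontrivial (K : pzRingType) (u : nat -> K) : Prop :=
  exists n : nat, u n <> 0.

Section Floquet.
Variable R : realType.
Implicit Types (a b u : nat -> R) (E k theta : R) (q : nat).

(* If u solves Ju = Eu then (u(n+1), u(n))^T = T_n (u(n), u(n-1))^T. *)
Definition transfer_step a b E (n : nat) : 'M[R]_2 :=
  \matrix_(i < 2, j < 2)
    if i == 0 then
      if j == 0 then (E - b n.+1) / a n.+1 else - (a n / a n.+1)
    else
      if j == 0 then 1 else 0.

(* T_n ... T_2 T_1 *)
Fixpoint transfer a b E (n : nat) : 'M[R]_2 :=
  match n with
  | 0 => 1%:M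
  | m.+1 => transfer_step a b E m.+1 *m transfer a b E m
  end.

Definition discriminant a b q E : R := \tr (transfer a b E q).

(* The union of the open bands (c_k, d_k), which are by definition the
   connected components of this set. *)
Definition open_bands a b q : set R :=
  [set E | `|discriminant a b q E| < 2].

Definition expi (t : R) : R[i] := Complex (cos t) (sin t).

(* phi(n) = p(n) e^{i (k/q) n} with p q-periodic on n >= 0, J_0 phi = E phi *)
Definition floquet_solution a b q E k (phi : nat -> R[i]) : Prop :=
  [/\ solves (fun n => real_complex R (a n)) (fun n => real_complex R (b n))
        (real_complex R E) phi,
      nontrivial phi &
      exists2 p : nat -> R[i], (forall n : nat, p (n + q)%N = p n) &
        forall n : nat, phi n = p n * expi (k / q%:R * n%:R)].

Definition is_quasimomentum a b q E k : Prop :=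
  0 < k < pi /\ exists phi : nat -> R[i], floquet_solution a b q E k phi.

(* For E in [open_bands a b q] there is exactly one k as above; the default
   value 0 is irrelevant. *)
Definition quasimomentum a b q E : R :=
  xget 0 [set k | is_quasimomentum a b q E k].

Definition square_summable u : Prop :=
  cvgn (series (fun n => u n ^+ 2)).

(* u(1)/u(0) = tan theta, where theta = pi/2 means u(0) = 0.  The condition
   u(0) <> 0 is explicit because [x / 0 = 0] in the library. *)
Definition boundary_condition theta u : Prop :=
  (theta = pi / 2 -> u 0%N = 0) /\
  (theta <> pi / 2 -> u 0%N <> 0 /\ u 1%N / u 0%N = tan theta).

End Floquet.

(* Main.v *)
Require Import Defs.
From HB Require Import structures.
From mathcomp Require Import all_boot all_order all_algebra.
From mathcomp Require Import all_classical all_reals all_analysis.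
From mathcomp Require Import complex.
From mathcomp Require Import ring lra zify.

Set Implicit Arguments.
Unset Strict Implicit.
Unset Printing Implicit Defensive.

Import Order.TTheory GRing.Theory Num.Theory.
Import numFieldNormedType.Exports.

Local Open Scope classical_set_scope.
Local Open Scope ring_scope.

(* Perturb only at the last site of each period. In Floquet coordinates the
   state at energy [E j] then undergoes, once per period, the rotation by the
   quasimomentum [k j] composed with a shear of strength [c j * v m], where
   [v m] is the perturbation in the m-th period; the shear changes the logarithm
   of the squared radius by [c j * v m * sin (2 theta_j)] up to [O(v m ^ 2)].
   Choose [v m = - (1 / (m + 1)) * \sum_j (4 / c j) * sin (2 theta_j m)], the
   sum ranging over the energies switched on before time [m]. The diagonal term
   makes the squared radius decay like [m ^ -2]; the cross terms
   [sin (2 theta_i) * sin (2 theta_j) / (m + 1)] have bounded partial sums by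
   Abel summation, because the angles [2 theta_i + 2 theta_j] and
   [2 theta_i - 2 theta_j] advance by nearly [2 (k i + k j)] and
   [2 (k i - k j)], which are not multiples of [2 pi]. The j-th energy is
   switched on so late that its total effect on the earlier ones is at most
   [2 ^ -j], and that the coefficients respect the growth allowed by [h]. *)

(** * Kicked rotations *)

Section KickedRotation.
Variable R : realType.
Implicit Types (z : R * R) (k eps : R).

Definition nsq z : R := z.1 ^+ 2 + z.2 ^+ 2.
(* Sine and cosine of twice the polar angle of [z]. *)
Definition sin2 z : R := 2 * z.1 * z.2 / nsq z.
Definition cos2 z : R := (z.1 ^+ 2 - z.2 ^+ 2) / nsq z.
Definition kick eps z : R * R := (z.1 + eps * z.2, z.2).
Definition rotate k z : R * R :=
  (cos k * z.1 - sin k * z.2, sin k * z.1 + cos k * z.2).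

Lemma nsq_rotate k z : nsq (rotate k z) = nsq z.
Proof.
rewrite /nsq /rotate /=; have := cos2Dsin2 k.
move: (cos k) (sin k) => c s h.
by rewrite -[RHS]mul1r -h; ring.
Qed.

Lemma nsq_kick eps z :
  nsq (kick eps z) = nsq z + 2 * eps * z.1 * z.2 + eps ^+ 2 * z.2 ^+ 2.
Proof. by rewrite /nsq /kick /=; ring. Qed.

Lemma nsq_kick_gt0 eps z : 0 < nsq z -> 0 < nsq (kick eps z).
Proof.
case: z => x y; rewrite /nsq /kick /= => h.
have [y0|y0] := eqVneq y 0; first by move: h; rewrite y0 mulr0 addr0.
by rewrite ltr_wpDl ?sqr_ge0 // exprn_even_gt0.
Qed.

Lemma sin2_cos2 z : 0 < nsq z -> sin2 z ^+ 2 + cos2 z ^+ 2 = 1.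
Proof. by rewrite /sin2 /cos2 /nsq => h; field; rewrite gt_eqF. Qed.

Lemma sin2_le1 z : 0 < nsq z -> `|sin2 z| <= 1.
Proof.
move=> /sin2_cos2 h.
have := sqr_ge0 (cos2 z); rewrite ler_norml; nra.
Qed.

Lemma cos2_le1 z : 0 < nsq z -> `|cos2 z| <= 1.
Proof.
move=> /sin2_cos2 h.
have := sqr_ge0 (sin2 z); rewrite ler_norml; nra.
Qed.

Lemma sin2_rotate k z : sin2 (rotate k z) =
  (cos k ^+ 2 - sin k ^+ 2) * sin2 z + 2 * cos k * sin k * cos2 z.
Proof. by rewrite /sin2 /cos2 nsq_rotate /=; ring. Qed.

Lemma cos2_rotate k z : cos2 (rotate k z) =
  (cos k ^+ 2 - sin k ^+ 2) * cos2 z - 2 * cos k * sin k * sin2 z.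
Proof. by rewrite /sin2 /cos2 nsq_rotate /=; ring. Qed.

(** The exact growth factor is 1 + [eps * sin2 z] plus a term at most [eps ^+ 2]; the inequality 1 +
    x <= exp x gives a bound that multiplies well along an orbit. *)
Lemma nsq_kick_le eps z : 0 < nsq z ->
  nsq (kick eps z) <= nsq z * expR (eps * sin2 z + eps ^+ 2).
Proof.
move=> h; apply: (@le_trans _ _ (nsq z * (1 + (eps * sin2 z + eps ^+ 2)))).
  have -> : nsq z * (1 + (eps * sin2 z + eps ^+ 2)) =
      nsq z + 2 * eps * z.1 * z.2 + eps ^+ 2 * nsq z.
    by rewrite /sin2; field; rewrite gt_eqF.
  rewrite nsq_kick lerD2l ler_wpM2l ?sqr_ge0 // /nsq.
  by rewrite lerDr sqr_ge0.
by rewrite ler_pM2l // expR_ge1Dx.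
Qed.

Lemma nsq_kick_ge eps z : `|eps| <= 4^-1 -> nsq z / 2 <= nsq (kick eps z).
Proof.
case: z => x y; rewrite nsq_kick /nsq /= ler_norml => /andP[h1 h2].
have := sqr_ge0 (x + y); have := sqr_ge0 (x - y); nra.
Qed.

(** Lipschitz bound shared by [sin2] and [cos2]. For |eps| above 1/4 it suffices that both quotients
    are at most 1; below, the difference carries a factor [eps] and the new denominator is at least
    half the old one. *)
Lemma norm_divB_kick eps z (f f' : R) (g : R) : 0 < nsq z ->
  `|f / nsq z| <= 1 -> `|f' / nsq (kick eps z)| <= 1 ->
  f' * nsq z - f * nsq (kick eps z) = eps * g ->
  (`|eps| <= 4^-1 -> `|g| <= 4 * nsq z ^+ 2) ->
  `|f' / nsq (kick eps z) - f / nsq z| <= 8 * `|eps|.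
Proof.
move=> r0 f1 f'1 fg gle; have r'0 := nsq_kick_gt0 eps r0.
have [e4|e4] := lerP `|eps| 4^-1; last first.
  apply: le_trans (ler_normB _ _) _; apply: le_trans (lerD f'1 f1) _.
  by have := e4; lra.
have -> : f' / nsq (kick eps z) - f / nsq z =
    eps * g / (nsq z * nsq (kick eps z)).
  by rewrite -fg; field; rewrite !gt_eqF.
rewrite !normrM normfV (gtr0_norm (mulr_gt0 r0 r'0)).
rewrite ler_pdivrMr ?mulr_gt0// [8 * _]mulrC -[leRHS]mulrA ler_wpM2l//.
apply: le_trans (gle e4) _; rewrite expr2.
have := nsq_kick_ge z e4; nra.
Qed.

Lemma sin2_kick eps z : 0 < nsq z ->
  `|sin2 (kick eps z) - sin2 z| <= 8 * `|eps|.
Proof.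
move=> r0; have r'0 := nsq_kick_gt0 eps r0.
apply: (@norm_divB_kick _ _ _ _
  (2 * z.2 ^+ 2 * (z.2 ^+ 2 - z.1 ^+ 2) - 2 * eps * z.1 * z.2 ^+ 3)) => //.
- exact: sin2_le1.
- exact: sin2_le1.
- by rewrite nsq_kick /nsq /=; ring.
case: z r0 {r'0} => x y; rewrite /nsq /= => r0 e4.
apply: le_trans (ler_normB _ _) _.
have xy : `|x * y| <= x ^+ 2 + y ^+ 2.
  by have := sqr_ge0 (x + y); have := sqr_ge0 (x - y); rewrite ler_norml; nra.
have -> : 2 * eps * x * y ^+ 3 = (2 * y ^+ 2) * (eps * (x * y)) by ring.
rewrite [in leLHS]normrM [X in _ + X]normrM !(ger0_norm (mulr_ge0 _ (sqr_ge0 _)))//.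
have h1 : `|y ^+ 2 - x ^+ 2| <= x ^+ 2 + y ^+ 2.
  by have := sqr_ge0 x; have := sqr_ge0 y; rewrite ler_norml; nra.
have h2 : `|eps * (x * y)| <= x ^+ 2 + y ^+ 2.
  rewrite normrM; have := normr_ge0 (x * y); have := normr_ge0 eps.
  by have := e4; nra.
have := sqr_ge0 x; have := sqr_ge0 y; nra.
Qed.

Lemma cos2_kick eps z : 0 < nsq z ->
  `|cos2 (kick eps z) - cos2 z| <= 8 * `|eps|.
Proof.
move=> r0; have r'0 := nsq_kick_gt0 eps r0.
apply: (@norm_divB_kick _ _ _ _
  ((2 * z.2 ^+ 2) * (2 * (z.1 * z.2) + eps * z.2 ^+ 2))) => //.
- exact: cos2_le1.
- exact: cos2_le1.
- by rewrite nsq_kick /nsq /=; ring.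
case: z r0 {r'0} => x y; rewrite /nsq /= => r0 e4.
rewrite normrM !(ger0_norm (mulr_ge0 _ (sqr_ge0 _)))//.
have h2 : `|2 * (x * y) + eps * y ^+ 2| <= 2 * (x ^+ 2 + y ^+ 2).
  move: e4; rewrite !ler_norml => /andP[? ?].
  have := sqr_ge0 (x + y); have := sqr_ge0 (x - y).
  by have := sqr_ge0 x; have := sqr_ge0 y; nra.
have := sqr_ge0 x; have := sqr_ge0 y; nra.
Qed.

Definition step k eps z : R * R := rotate k (kick eps z).

Lemma nsq_step_gt0 k eps z : 0 < nsq z -> 0 < nsq (step k eps z).
Proof. by rewrite nsq_rotate; exact: nsq_kick_gt0. Qed.

Lemma norm_rotate_err (p1 q1 s c s' c' e : R) : p1 ^+ 2 + q1 ^+ 2 = 1 ->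
  `|s' - s| <= e -> `|c' - c| <= e ->
  `|p1 * s' + q1 * c' - (p1 * s + q1 * c)| <= 2 * e.
Proof.
move=> pq hs hc.
have -> : p1 * s' + q1 * c' - (p1 * s + q1 * c) =
  p1 * (s' - s) + q1 * (c' - c) by ring.
have hp : `|p1| <= 1 by have := sqr_ge0 q1; rewrite ler_norml; nra.
have hq : `|q1| <= 1 by have := sqr_ge0 p1; rewrite ler_norml; nra.
apply: le_trans (ler_normD _ _) _; rewrite !normrM.
have := normr_ge0 p1; have := normr_ge0 q1.
have := normr_ge0 (s' - s); have := normr_ge0 (c' - c).
nra.
Qed.

Lemma double_circle (p q : R) : p ^+ 2 + q ^+ 2 = 1 ->
  (p ^+ 2 - q ^+ 2) ^+ 2 + (2 * p * q) ^+ 2 = 1.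
Proof.
move=> h; transitivity ((p ^+ 2 + q ^+ 2) ^+ 2); first by ring.
by rewrite h expr1n.
Qed.

(** The coefficients are the cosine and sine of [2 * k]: up to O(|eps|) the doubled angle turns by
    [2 * k]. *)
Lemma sin2_step k eps z : 0 < nsq z ->
  `|sin2 (step k eps z) -
    ((cos k ^+ 2 - sin k ^+ 2) * sin2 z + 2 * cos k * sin k * cos2 z)|
  <= 16 * `|eps|.
Proof.
move=> r0; rewrite sin2_rotate.
have := norm_rotate_err (double_circle (cos2Dsin2 k))
  (sin2_kick eps r0) (cos2_kick eps r0).
by move/le_trans; apply; lra.
Qed.

Lemma cos2_step k eps z : 0 < nsq z ->
  `|cos2 (step k eps z) -
    ((cos k ^+ 2 - sin k ^+ 2) * cos2 z - 2 * cos k * sin k * sin2 z)|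
  <= 16 * `|eps|.
Proof.
move=> r0; rewrite cos2_rotate.
have := double_circle (cos2Dsin2 k); rewrite -[(2 * _ * _) ^+ 2]sqrrN => h.
have := norm_rotate_err h (cos2_kick eps r0) (sin2_kick eps r0).
by rewrite !mulNr; move/le_trans; apply; lra.
Qed.

Lemma nsq_step_le k eps z : 0 < nsq z ->
  nsq (step k eps z) <= nsq z * expR (eps * sin2 z + eps ^+ 2).
Proof. by rewrite nsq_rotate; exact: nsq_kick_le. Qed.

Definition conj z : R * R := (z.1, - z.2).

Lemma nsq_conj z : nsq (conj z) = nsq z.
Proof. by rewrite /nsq /= sqrrN. Qed.

Lemma sin2_conj z : sin2 (conj z) = - sin2 z.
Proof. by rewrite /sin2 nsq_conj /= mulrN mulNr. Qed.

Lemma cos2_conj z : cos2 (conj z) = cos2 z.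
Proof. by rewrite /cos2 nsq_conj /= sqrrN. Qed.

Lemma conj_step k eps z : conj (step k eps z) = step (- k) (- eps) (conj z).
Proof. by rewrite /conj /step /rotate /kick /= cosN sinN; congr (_, _); ring. Qed.

End KickedRotation.

(** * Oscillating sums *)

Section Oscillation.
Variable R : realType.
Implicit Types (A B L e : nat -> R) (m n M N : nat).

(** This is (m + 1)^(-3/2), the common summable majorant of all second-order errors. *)
Definition rho m : R := (m.+1%:R * Num.sqrt m.+1%:R)^-1.

Lemma sqrtS_ge1 m : 1 <= Num.sqrt m.+1%:R :> R.
Proof. by rewrite -[leLHS]sqrtr1 ler_sqrt ?ler1n. Qed.

(** With s and t the two square roots, (t - s) (t + s) = 1, so the right side is 4 / (s t (s + t)),
    comparable with 1 / s^3. It makes sums of [rho] telescope. *)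
Lemma rho_le m :
  rho m <= 4 / Num.sqrt m.+1%:R - 4 / Num.sqrt m.+2%:R.
Proof.
rewrite /rho; have s1 := sqrtS_ge1 m; have t1 := sqrtS_ge1 m.+1.
have sq : Num.sqrt m.+1%:R ^+ 2 = m.+1%:R :> R by rewrite sqr_sqrtr.
have tq : Num.sqrt m.+2%:R ^+ 2 = m.+1%:R + 1 :> R.
  by rewrite sqr_sqrtr// -[in LHS]natr1.
move: (Num.sqrt m.+2%:R) (Num.sqrt m.+1%:R) s1 t1 sq tq => t s s1 t1 <- tq.
have -> : 4 / s - 4 / t = (4 * s ^+ 2 * (t - s)) / (s ^+ 2 * s * t).
  by field; apply/andP; split; apply: lt0r_neq0; lra.
rewrite ler_pdivlMr; last by rewrite !mulr_gt0//; lra.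
rewrite mulKf; last by apply: lt0r_neq0; rewrite mulr_gt0// ?exprn_gt0//; lra.
have ts : (t - s) * (t + s) = 1 by rewrite -subr_sqr tq; ring.
have ts0 : 0 < t + s by lra.
have -> : 4 * s ^+ 2 * (t - s) = 4 * s ^+ 2 * ((t - s) * (t + s)) / (t + s).
  by field; apply: lt0r_neq0.
by rewrite ts ler_pdivlMr//; nra.
Qed.

(** Summation by parts: the increments of the bounded [L] leave boundary terms and the variation of
    1 / (m + 1), while the errors [D * e m] are summed by [rho_le]. *)
Lemma abel_sum A L e (B D : R) : 0 <= D ->
  (forall m, `|L m| <= B) ->
  (forall m, `|A m - (L m.+1 - L m)| <= D * e m) ->
  (forall m, e m / m.+1%:R <= rho m) ->
  forall M N, (M <= N)%N ->
  `|\sum_(M <= m < N) A m / m.+1%:R| <= (2 * B + 4 * D) / Num.sqrt M.+1%:R.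
Proof.
move=> D0 LB AL er M N /subnKC <-; move: (N - M)%N => n.
have Mi k : 0 < k.+1%:R^-1 :> R by rewrite invr_gt0.
have B0 : 0 <= B := le_trans (normr_ge0 _) (LB 0%N).
(* Keeping the boundary terms of [L] exact makes both majorants telescope in the induction. *)
have key : `|\sum_(M <= m < M + n) A m / m.+1%:R -
    (L (M + n)%N / (M + n).+1%:R - L M / M.+1%:R)| <=
    B * (M.+1%:R^-1 - (M + n).+1%:R^-1) +
    D * (4 / Num.sqrt M.+1%:R - 4 / Num.sqrt (M + n).+1%:R).
  elim: n => [|n IH]; first by rewrite addn0 big_geq// !subrr normr0 !mulr0 addr0.
  rewrite addnS big_nat_recr ?leq_addr//=.
  set k := (M + n)%N in IH *; set S := \sum_(_ <= _ < _) _ in IH *.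
  have -> : S + A k / k.+1%:R - (L k.+1 / k.+2%:R - L M / M.+1%:R) =
    (S - (L k / k.+1%:R - L M / M.+1%:R)) +
    ((A k - (L k.+1 - L k)) / k.+1%:R +
     L k.+1 * (k.+1%:R^-1 - k.+2%:R^-1)) by ring.
  apply: le_trans (ler_normD _ _) _; apply: le_trans (lerD IH (ler_normD _ _)) _.
  rewrite !normrM (ger0_norm (ltW (Mi _))).
  have k12 : 0 <= k.+1%:R^-1 - k.+2%:R^-1 :> R.
    by rewrite subr_ge0 lef_pV2 ?posrE// ler_nat.
  rewrite (ger0_norm k12).
  have h1 : `|L k.+1| * (k.+1%:R^-1 - k.+2%:R^-1) <= B * (k.+1%:R^-1 - k.+2%:R^-1).
    exact: ler_wpM2r.
  have h2 : `|A k - (L k.+1 - L k)| / k.+1%:R <=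
      D * (4 / Num.sqrt k.+1%:R - 4 / Num.sqrt k.+2%:R).
    apply: (@le_trans _ _ (D * (e k / k.+1%:R))).
      by rewrite mulrA ler_wpM2r// ltW.
    by rewrite ler_wpM2l// (le_trans (er k))// rho_le.
  move: h1 h2; move: (`|_| * _) (`|_| / _) => x y.
  move: (M.+1%:R^-1) (k.+1%:R^-1) (k.+2%:R^-1) => a b c.
  by move: (4 / _) (4 / _) (4 / _) => a' b' c'; lra.
have sM := sqrtS_ge1 M.
have sM0 : 0 < Num.sqrt M.+1%:R :> R by exact: lt_le_trans sM.
have Ms : M.+1%:R^-1 <= (Num.sqrt M.+1%:R)^-1 :> R.
  rewrite lef_pV2 ?posrE ?ltr0n//.
  by rewrite -[leRHS](@sqr_sqrtr _ M.+1%:R)// expr2 ler_peMl// ltW.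
have bM : `|L M / M.+1%:R| <= B / M.+1%:R.
  by rewrite normrM (ger0_norm (ltW (Mi _))) ler_wpM2r// ltW.
have bN : `|L (M + n)%N / (M + n).+1%:R| <= B / (M + n).+1%:R.
  by rewrite normrM (ger0_norm (ltW (Mi _))) ler_wpM2r// ltW.
have tN : 0 <= D * (4 / Num.sqrt (M + n).+1%:R).
  by rewrite mulr_ge0// divr_ge0.
have BM : B * M.+1%:R^-1 <= B * (Num.sqrt M.+1%:R)^-1 by rewrite ler_wpM2l.
move: key bM bN tN BM; move: (L M / _) (L (M + n)%N / _) => x y.
move: (M.+1%:R^-1) ((M + n).+1%:R^-1) => a b.
move: (Num.sqrt M.+1%:R)^-1 (Num.sqrt (M + n).+1%:R)^-1 => s t.
rewrite !ler_norml !mulrBr => /andP[? ?] /andP[? ?] /andP[? ?] ? ?.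
apply/andP; split; lra.
Qed.

(* [L = (C / S * B - A) / 2] solves the cohomological equation
   [L \o rotation - L = A] for the rotation whose half angle has cosine C and
   sine S. *)
Lemma rotating_sum (C S D : R) : C ^+ 2 + S ^+ 2 = 1 -> S != 0 -> 0 <= D ->
  exists2 Q : R, 0 <= Q & forall A B e,
  (forall m, `|A m| <= 2) -> (forall m, `|B m| <= 2) ->
  (forall m, `|A m.+1 - ((C ^+ 2 - S ^+ 2) * A m - 2 * C * S * B m)| <=
             D * e m) ->
  (forall m, `|B m.+1 - (2 * C * S * A m + (C ^+ 2 - S ^+ 2) * B m)| <=
             D * e m) ->
  (forall m, e m / m.+1%:R <= rho m) ->
  forall M N, (M <= N)%N ->
  `|\sum_(M <= m < N) A m / m.+1%:R| <= Q / Num.sqrt M.+1%:R.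
Proof.
move=> CS S0 D0; have [b bE] : {b : R | b = C / S / 2} by eexists.
have D'0 : 0 <= (2^-1 + `|b|) * D.
  by rewrite mulr_ge0// addr_ge0.
(* [abel_sum] is used with |L| <= 1 + 2 |b|, since |A| and |B| are at most 2, and with error factor
   (1/2 + |b|) D. *)
exists (2 * (1 + 2 * `|b|) + 4 * ((2^-1 + `|b|) * D)).
  by have := normr_ge0 b; lra.
move=> A B e A2 B2 hA hB er M N MN.
apply: (@abel_sum A (fun m => - (A m / 2) + b * B m) e) => // m.
  apply: le_trans (ler_normD _ _) _.
  rewrite normrN !normrM normfV normr_nat.
  have := A2 m; have := ler_wpM2l (normr_ge0 b) (B2 m); lra.
have -> : A m - (- (A m.+1 / 2) + b * B m.+1 - (- (A m / 2) + b * B m)) =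
   (A m.+1 - ((C ^+ 2 - S ^+ 2) * A m - 2 * C * S * B m)) / 2 -
   b * (B m.+1 - (2 * C * S * A m + (C ^+ 2 - S ^+ 2) * B m)).
  have e1 : b * (2 * C * S * A m + (C ^+ 2 - S ^+ 2) * B m) =
    C ^+ 2 * A m - C * S * B m + b * (C ^+ 2 + S ^+ 2) * B m.
    by rewrite bE; field.
  have e2 : (C ^+ 2 - S ^+ 2) * A m = 2 * C ^+ 2 * A m - (C ^+ 2 + S ^+ 2) * A m.
    by ring.
  by rewrite [b * (_ - _)]mulrBr e1 e2 CS; field.
apply: le_trans (ler_normB _ _) _; rewrite !normrM normfV normr_nat.
have := hA m; have := ler_wpM2l (normr_ge0 b) (hB m).
move: `|A m.+1 - _| `|B m.+1 - _| `|b| (e m) => x y z w; lra.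
Qed.

End Oscillation.

(** * Correlations between the angles of two kicked orbits *)

Section KickedOrbits.
Variable R : realType.
Implicit Types (v : nat -> R) (z : nat -> R * R) (m n M N : nat).

Definition kicked (k c : R) v z : Prop :=
  (forall m, 0 < nsq (z m)) /\ forall m, z m.+1 = step k (c * v m) (z m).

Lemma norm_mulB (x y x' y' a b : R) : `|x'| <= 1 -> `|y| <= 1 ->
  `|x' - x| <= a -> `|y' - y| <= b -> `|x' * y' - x * y| <= a + b.
Proof.
move=> x1 y1 xa yb.
have -> : x' * y' - x * y = (x' - x) * y + x' * (y' - y) by ring.
apply: le_trans (ler_normD _ _) _; rewrite !normrM.
have := ler_wpM2l (normr_ge0 (x' - x)) y1.
have := ler_wpM2r (normr_ge0 (y' - y)) x1.
lra.
Qed.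

(** The numerator is the cosine of the sum of the doubled angles, which advances by 2 (k1 + k2) up
    to O(|v m|); the condition on the sine excludes resonance. [Q] is fixed before [v], so a later
    choice of [v] may depend on it. *)
Lemma sum_cos2D (k1 k2 c1 c2 : R) : sin (k1 + k2) != 0 ->
  exists2 Q : R, 0 <= Q & forall v z1 z2,
    kicked k1 c1 v z1 -> kicked k2 c2 v z2 ->
    (forall m, `|v m| / m.+1%:R <= rho R m) -> forall M N, (M <= N)%N ->
  `|\sum_(M <= m < N)
     (cos2 (z1 m) * cos2 (z2 m) - sin2 (z1 m) * sin2 (z2 m)) / m.+1%:R|
  <= Q / Num.sqrt M.+1%:R.
Proof.
(* Each of the two products below errs by at most 16 |c1 v m| + 16 |c2 v m|. *)
move=> S0; have [D DE] : {D : R | D = 32 * (`|c1| + `|c2|)} by eexists.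
have D0 : 0 <= D by rewrite DE mulr_ge0// addr_ge0.
have [Q Q0 HQ] := rotating_sum (cos2Dsin2 (k1 + k2)) S0 D0.
exists Q => // v z1 z2 [z10 z1S] [z20 z2S] vr M N MN.
pose B m := sin2 (z1 m) * cos2 (z2 m) + cos2 (z1 m) * sin2 (z2 m).
have bnd (x y z t : R) :
    `|x| <= 1 -> `|y| <= 1 -> `|z| <= 1 -> `|t| <= 1 -> `|x * y + z * t| <= 2.
  move=> x1 y1 z1' t1; apply: le_trans (ler_normD _ _) _; rewrite !normrM.
  have := ler_pM (normr_ge0 x) (normr_ge0 y) x1 y1.
  have := ler_pM (normr_ge0 z) (normr_ge0 t) z1' t1.
  by rewrite mulr1; lra.
apply: (HQ (fun m => _) B (fun m => `|v m|)) => //= m.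
- by rewrite -mulNr; apply: bnd; rewrite ?normrN ?sin2_le1 ?cos2_le1.
- by apply: bnd; rewrite ?sin2_le1 ?cos2_le1.
- rewrite z1S z2S cosD sinD.
  rewrite (_ : _ - _ = (cos2 (step k1 (c1 * v m) (z1 m)) *
      cos2 (step k2 (c2 * v m) (z2 m)) -
      cos2 (rotate k1 (z1 m)) * cos2 (rotate k2 (z2 m))) -
     (sin2 (step k1 (c1 * v m) (z1 m)) * sin2 (step k2 (c2 * v m) (z2 m)) -
      sin2 (rotate k1 (z1 m)) * sin2 (rotate k2 (z2 m)))); last first.
    by rewrite /B !cos2_rotate !sin2_rotate; ring.
  apply: le_trans (ler_normB _ _) _.
  apply: (@le_trans _ _ ((16 * `|c1 * v m| + 16 * `|c2 * v m|) +
                         (16 * `|c1 * v m| + 16 * `|c2 * v m|))).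
    apply: lerD; apply: norm_mulB;
    rewrite ?cos2_le1 ?sin2_le1 ?nsq_step_gt0 ?nsq_rotate//.
    + by rewrite cos2_rotate; exact: cos2_step.
    + by rewrite cos2_rotate; exact: cos2_step.
    + by rewrite sin2_rotate; exact: sin2_step.
    + by rewrite sin2_rotate; exact: sin2_step.
  by rewrite !normrM DE; lra.
- rewrite /B z1S z2S cosD sinD.
  rewrite (_ : _ - _ = (sin2 (step k1 (c1 * v m) (z1 m)) *
      cos2 (step k2 (c2 * v m) (z2 m)) -
      sin2 (rotate k1 (z1 m)) * cos2 (rotate k2 (z2 m))) +
     (cos2 (step k1 (c1 * v m) (z1 m)) * sin2 (step k2 (c2 * v m) (z2 m)) -
      cos2 (rotate k1 (z1 m)) * sin2 (rotate k2 (z2 m)))); last first.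
    by rewrite !cos2_rotate !sin2_rotate; ring.
  apply: le_trans (ler_normD _ _) _.
  apply: (@le_trans _ _ ((16 * `|c1 * v m| + 16 * `|c2 * v m|) +
                         (16 * `|c1 * v m| + 16 * `|c2 * v m|))).
    apply: lerD; apply: norm_mulB;
    rewrite ?cos2_le1 ?sin2_le1 ?nsq_step_gt0 ?nsq_rotate//.
    + by rewrite sin2_rotate; exact: sin2_step.
    + by rewrite cos2_rotate; exact: cos2_step.
    + by rewrite cos2_rotate; exact: cos2_step.
    + by rewrite sin2_rotate; exact: sin2_step.
  by rewrite !normrM DE; lra.
Qed.

Lemma kicked_conj k c v z :
  kicked k c v z -> kicked (- k) (- c) v (fun m => conj (z m)).
Proof.
move=> [z0 zS]; split=> m; first by rewrite nsq_conj.
by rewrite zS conj_step mulNr.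
Qed.

(* Conjugating the second orbit reduces differences of angles to sums. *)
Lemma sum_sin2_sin2 (k1 k2 c1 c2 : R) :
  sin (k1 + k2) != 0 -> sin (k1 - k2) != 0 ->
  exists2 Q : R, 0 <= Q & forall v z1 z2,
    kicked k1 c1 v z1 -> kicked k2 c2 v z2 ->
    (forall m, `|v m| / m.+1%:R <= rho R m) -> forall M N, (M <= N)%N ->
  `|\sum_(M <= m < N) sin2 (z1 m) * sin2 (z2 m) / m.+1%:R|
  <= Q / Num.sqrt M.+1%:R.
Proof.
move=> /(sum_cos2D c1 c2)[Q Q0 HQ] /(sum_cos2D c1 (- c2))[Q' Q'0 HQ'].
exists (Q + Q'); first exact: addr_ge0.
move=> v z1 z2 o1 o2 vr M N MN.
have := HQ v z1 z2 o1 o2 vr M N MN.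
have := HQ' v z1 _ o1 (kicked_conj o2) vr M N MN.
under [in X in X -> _]eq_bigr do rewrite cos2_conj sin2_conj.
set S' := \sum_(_ <= _ < _) _; set S := \sum_(_ <= _ < _) _.
have -> : \sum_(M <= m < N) sin2 (z1 m) * sin2 (z2 m) / m.+1%:R = (S' - S) / 2.
  rewrite /S' /S -sumrB mulr_suml; apply: eq_bigr => m _; field.
  by rewrite ?nat1r ?natr1 pnatr_eq0.
move=> h' h; rewrite normrM normfV normr_nat.
have := ler_normB S' S; have := normr_ge0 (S' - S).
by move: h' h; rewrite mulrDl; lra.
Qed.

(** Twice a squared sine is 1 minus the cosine of the doubled argument, and the cosine sum is
    [sum_cos2D] for the orbit paired with itself. *)
Lemma sum_sin2_sqr (k c : R) : sin (k + k) != 0 ->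
  exists2 Q : R, 0 <= Q & forall v z, kicked k c v z ->
    (forall m, `|v m| / m.+1%:R <= rho R m) -> forall M N, (M <= N)%N ->
  \sum_(M <= m < N) m.+1%:R^-1 - Q <=
  2 * \sum_(M <= m < N) sin2 (z m) * sin2 (z m) / m.+1%:R.
Proof.
move=> /(sum_cos2D c c)[Q Q0 HQ]; exists Q => // v z o vr M N MN.
have := HQ v z z o o vr M N MN; set S := \sum_(_ <= _ < _) _.
have -> : 2 * \sum_(M <= m < N) sin2 (z m) * sin2 (z m) / m.+1%:R =
    \sum_(M <= m < N) m.+1%:R^-1 - S.
  rewrite /S -sumrB mulr_sumr; apply: eq_bigr => m _.
  have := sin2_cos2 (o.1 m).
  move: (sin2 _) (cos2 _) (m.+1%:R^-1) => s d w h.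
  by have -> : d * d = 1 - s * s by [lra]; ring.
have QM : Q / Num.sqrt M.+1%:R <= Q.
  by rewrite ler_pdivrMr ?ler_peMr ?sqrtS_ge1// (lt_le_trans _ (sqrtS_ge1 _ M)).
by rewrite ler_norml => /andP[_]; lra.
Qed.

End KickedOrbits.

(** * Simultaneous decay *)

Section Construction.
Variable R : realType.
Implicit Types (a v : nat -> R) (z : nat -> R * R) (i j m n M N : nat).

(** The largest index below [n] satisfying [P] decides: its initial segment contains all the
    others. *)
Lemma sum_active_le a (P : pred nat) (B : R) n : 0 <= B ->
  (forall j, 0 <= a j) -> (forall j, P j -> \sum_(0 <= i < j.+1) a i <= B) ->
  \sum_(0 <= j < n | P j) a j <= B.
Proof.
move=> B0 a0 PB; elim: n => [|n IH]; first by rewrite big_geq.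
rewrite big_mkcond big_nat_recr//= -big_mkcond /=.
case: ifP => Pn; last by rewrite addr0.
apply: le_trans (PB n Pn); rewrite big_nat_recr//= lerD2r.
by rewrite [leLHS]big_mkcond ler_sum// => i _; case: ifP.
Qed.

Lemma sum_below_le a i n : (forall j, 0 <= a j) ->
  \sum_(0 <= j < n) (if (j < i)%N then a j else 0) <= \sum_(0 <= j < i) a j.
Proof.
move=> a0; rewrite -big_mkcond (big_nat_widen _ _ (n + i)) ?leq_addr//=.
rewrite [leRHS](big_nat_widen _ _ (n + i)) ?leq_addl//= [leRHS]big_mkcond.
rewrite [leLHS]big_mkcond ler_sum// => j _ /=.
by case: (j < i)%N => //=; case: ifP.
Qed.

Lemma sum_head_tail_ge a M N : (forall j, 0 <= a j) ->
  \sum_(0 <= m < N) a m <= \sum_(0 <= m < M) a m + \sum_(M <= m < N) a m.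
Proof.
move=> a0; have [MN|/ltnW NM] := leqP M N; first by rewrite -big_cat_nat.
by rewrite [X in _ + X]big_geq// addr0 [leRHS](big_cat_nat _ NM)//= lerDl sumr_ge0.
Qed.

Lemma sum_half_pow n : \sum_(0 <= j < n) (2 ^+ j)^-1 <= 2 :> R.
Proof.
suff : \sum_(0 <= j < n) (2 ^+ j)^-1 = 2 - 2 / 2 ^+ n :> R.
  by move=> ->; rewrite gerBl divr_ge0.
elim: n => [|n IH]; first by rewrite big_geq// expr0; lra.
rewrite big_nat_recr//= IH exprS; field.
by rewrite expf_neq0.
Qed.

Lemma sum_rho_le N : \sum_(0 <= m < N) rho R m <= 4.
Proof.
suff : \sum_(0 <= m < N) rho R m <= 4 - 4 / Num.sqrt N.+1%:R.
  by move/le_trans; apply; rewrite gerBl divr_ge0.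
elim: N => [|N IH]; first by rewrite big_geq// sqrtr1; lra.
by rewrite big_nat_recr//=; have := rho_le R N; move: IH; lra.
Qed.

(** The product of the factors 1 + 1 / (m + 1) <= exp (1 / (m + 1)) telescopes. *)
Lemma expR_harmonic N : N.+1%:R <= expR (\sum_(0 <= m < N) m.+1%:R^-1) :> R.
Proof.
elim: N => [|N IH]; first by rewrite big_geq// expR0.
rewrite big_nat_recr//= expRD.
apply: (@le_trans _ _ (N.+1%:R * (1 + N.+1%:R^-1))).
  by rewrite mulrDr mulr1 divff ?pnatr_eq0// natr1.
by apply: ler_pM => //; exact: expR_ge1Dx.
Qed.

Lemma kicked_le k c v z N : kicked k c v z ->
  nsq (z N) <= nsq (z 0%N) *
   expR (\sum_(0 <= m < N) (c * v m * sin2 (z m) + (c * v m) ^+ 2)).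
Proof.
move=> [z0 zS]; elim: N => [|N IH]; first by rewrite big_geq// expR0 mulr1.
rewrite zS big_nat_recr//= expRD mulrA.
apply: le_trans (nsq_step_le _ _ (z0 N)) _.
by rewrite ler_wpM2r// expR_ge0.
Qed.

(** The fourth root of m + 1 is the largest growth for which |x| <= [ramp m] / (m + 1) still gives
    x^2 <= [rho R m]. *)
Definition ramp m : R := Num.sqrt (Num.sqrt m.+1%:R).

Lemma ramp_ge1 m : 1 <= ramp m.
Proof. by rewrite -[leLHS]sqrtr1 ler_sqrt ?sqrtS_ge1. Qed.

Lemma ramp_sqr m : ramp m ^+ 2 = Num.sqrt m.+1%:R.
Proof. by rewrite sqr_sqrtr. Qed.

Lemma ramp_cvg : ramp @ \oo --> +oo.
Proof.
apply/cvgryPge => A; near=> m.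
have [A0|A0] := lerP A 0.
  by rewrite (le_trans A0)// sqrtr_ge0.
have : (Num.bound (A ^+ 4) <= m.+1)%N.
  by rewrite leqW//; near: m; exact: nbhs_infty_ge.
rewrite -(ler_nat R) => h.
have {h} : A ^+ 4 <= m.+1%:R.
  by apply: le_trans h; apply/ltW/archi_boundP/exprn_ge0/ltW.
rewrite (_ : A ^+ 4 = (A ^+ 2) ^+ 2); last by ring.
move=> h; rewrite -[leLHS](ger0_norm (ltW A0)) -sqrtr_sqr ler_sqrt//.
by rewrite -[leLHS](ger0_norm (sqr_ge0 _)) -sqrtr_sqr ler_sqrt.
Unshelve. all: by end_near. Qed.

Lemma ramp_rho m (x : R) : `|x| <= ramp m / m.+1%:R ->
  `|x| / m.+1%:R <= rho R m /\ x ^+ 2 <= rho R m.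
Proof.
rewrite /rho; have w1 := ramp_ge1 m.
have sq : (ramp m ^+ 2) ^+ 2 = m.+1%:R by rewrite ramp_sqr sqr_sqrtr.
rewrite -ramp_sqr -sq; move: (ramp m) w1 => w w1 xw.
have w0 : 0 < w by lra.
have w4 : 0 < (w ^+ 2) ^+ 2 by rewrite !exprn_gt0.
have -> : ((w ^+ 2) ^+ 2 * w ^+ 2)^-1 = w ^+ 2 / (w ^+ 2) ^+ 2 / (w ^+ 2) ^+ 2.
  by field; rewrite lt0r_neq0.
split.
  rewrite ler_pM2r ?invr_gt0//.
  by apply: le_trans xw _; rewrite ler_pM2r ?invr_gt0// expr2; nra.
rewrite -real_normK ?num_real// -mulrA -invfM -[X in _ / X]expr2 -expr_div_n.
by rewrite ler_pXn2r ?nnegrE// divr_ge0 ?ltW.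
Qed.

(** The perturbation is a feedback law: [V m'] reads the states of all energies at time [m'], so the
    whole family advances at once. *)
Fixpoint orbits (k c : nat -> R) (V : nat -> (nat -> R * R) -> R) z m
    : nat -> R * R :=
  if m is m'.+1 then
    fun j => step (k j) (c j * V m' (orbits k c V z m'))
                  (orbits k c V z m' j)
  else z.

End Construction.

Lemma simultaneous_decay (R : realType) (k c : nat -> R) (z0 : nat -> R * R)
    (H : nat -> R) :
  (forall i j, sin (k i + k j) != 0) ->
  (forall i j, i <> j -> sin (k i - k j) != 0) ->
  (forall j, c j != 0) -> (forall j, 0 < nsq (z0 j)) ->
  (forall m, 0 < H m) -> H @ \oo --> +oo ->
  exists2 v : nat -> R, (forall m, `|v m| <= H m / m.+1%:R) &
    forall j, exists z : nat -> R * R, [/\ z 0%N = z0 j,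
      kicked (k j) (c j) v z &
      exists2 K, 0 <= K & forall m, nsq (z m) <= K / m.+1%:R ^+ 2].
Proof.
move=> kD kB c0 z00 H0 Hoo.
(* The constants are collected before [v] exists, since the switch-on times depend on them. The
   diagonal receives a dummy 0; [sum_sin2_sqr] handles it. *)
have /choice[Q HQ] : forall ij : nat * nat, exists Q : R, 0 <= Q /\
    (ij.1 <> ij.2 -> forall v z1 z2,
    kicked (k ij.1) (c ij.1) v z1 -> kicked (k ij.2) (c ij.2) v z2 ->
    (forall m, `|v m| / m.+1%:R <= rho R m) -> forall M N, (M <= N)%N ->
  `|\sum_(M <= m < N) sin2 (z1 m) * sin2 (z2 m) / m.+1%:R|
  <= Q / Num.sqrt M.+1%:R).
  move=> [i j] /=; have [->|/eqP ij] := eqVneq i j; first by exists 0.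
  have [Q Q0 HQ] := sum_sin2_sin2 (c i) (c j) (kD i j) (kB i j ij).
  by exists Q.
(* The diagonal term becomes -4 sin^2 / (m + 1), on average -2 / (m + 1): this is the source of the
   exponent 2. *)
pose d j := 4 / c j.
(* [W i j] bounds the total effect of energy [j] on the logarithm of the squared radius of energy
   [i]; [T j] adds this over the earlier energies, and [G j] is the size of all coefficients through
   [j]. *)
pose W i j := `|c i * d j| * Q (i, j).
have W0 i j : 0 <= W i j by rewrite mulr_ge0//; case: (HQ (i, j)).
pose T j := \sum_(0 <= i < j) W i j.
pose G j := \sum_(0 <= i < j.+1) `|d i|.
(* [Mt j] is the switch-on time. The bounds on [G j] control |v|, the bound on [T j] limits the
   effect on earlier energies to 2^-j, and j <= [Mt j] keeps the energies active at time m within j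
   <= m. *)
have /choice[Mt HM] : forall j, exists M, (j <= M)%N /\ forall m, (M <= m)%N ->
    [/\ G j <= H m, G j <= ramp R m & 2 ^+ j * T j <= ramp R m].
  move=> j.
  have [M1 _ h1] := (cvgryPge _).1 Hoo (G j).
  have [M2 _ h2] := (cvgryPge _).1 (@ramp_cvg R) (Num.max (G j) (2 ^+ j * T j)).
  exists (maxn j (maxn M1 M2)); split=> [|m]; first exact: leq_maxl.
  rewrite !geq_max => /and3P[_ m1 m2].
  by have := h2 m m2; rewrite /= ge_max => /andP[]; split=> //; exact: h1.
pose V m (s : nat -> R * R) :=
  - (\sum_(0 <= j < m.+1 | (Mt j <= m)%N) d j * sin2 (s j)) / m.+1%:R.
pose z m := orbits k c V z0 m.
pose v m := V m (z m).
have zk j : kicked (k j) (c j) v (fun m => z m j).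
  split=> [m|//]; elim: m => [|m IH]; first exact: z00.
  exact: nsq_step_gt0.
have vG m (B : R) : 0 <= B -> (forall j, (Mt j <= m)%N -> G j <= B) ->
    `|v m| <= B / m.+1%:R.
  move=> B0 GB; rewrite /v /V normrM normrN normfV normr_nat.
  rewrite ler_wpM2r// (le_trans (ler_norm_sum _ _ _))//.
  have := @sum_active_le R (fun j => `|d j|) (fun j => Mt j <= m)%N B m.+1 B0
    (fun j => normr_ge0 _) GB.
  apply: le_trans; apply: ler_sum => j _; rewrite normrM ler_piMr//.
  by apply: sin2_le1; case: (zk j).
exists v => [m|i].
  by apply: vG => [|j /(HM j).2 []//]; exact: ltW.
have vr m : `|v m| / m.+1%:R <= rho R m /\ v m ^+ 2 <= rho R m.
  apply: ramp_rho; apply: vG => [|j /(HM j).2 []//].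
  exact: le_trans (ramp_ge1 R m).
exists (fun m => z m i); split=> //.
have [Qi Qi0 HQi] := sum_sin2_sqr (c i) (kD i i).
(* Earlier energies cost [W i j], later ones 2^-j; granting 2^-j to every j is harmless and easy to
   sum. *)
pose U j := (if (j < i)%N then W i j else 0) + (2 ^+ j)^-1.
pose S j N := \sum_(Mt j <= m < N) sin2 (z m i) * sin2 (z m j) / m.+1%:R.
have HS j N : j <> i -> - (c i * d j * S j N) <= U j.
  move=> /nesym ij.
  have SQ : `|c i * d j * S j N| <= W i j / Num.sqrt (Mt j).+1%:R.
    rewrite normrM /W -mulrA ler_wpM2l//.
    have [Q0 HQij] := HQ (i, j).
    have [MN|/ltnW NM] := leqP (Mt j) N.
      exact: (HQij ij _ _ _ (zk i) (zk j) (fun m => (vr m).1)).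
    by rewrite /S big_geq// normr0 divr_ge0.
  have s1 := sqrtS_ge1 R (Mt j).
  apply: le_trans (_ : `|c i * d j * S j N| <= _);
    first by rewrite -normrN ler_norm.
  (* For j < i the square root is only used as being at least 1; for i < j it is at least
     [ramp R (Mt j)], hence at least 2^j T j. *)
  apply: le_trans SQ _; rewrite /U; case: ltnP => [ji|].
    rewrite ler_wpDr// ?invr_ge0 ?exprn_ge0//.
    by rewrite ler_pdivrMr ?ler_peMr// (lt_le_trans _ s1).
  rewrite leq_eqVlt => /orP[/eqP//|lij]; rewrite add0r.
  rewrite ler_pdivrMr ?(lt_le_trans _ s1)// mulrC ler_pdivlMr ?exprn_gt0//.
  have [_ _] := (HM j).2 _ (leqnn _).
  have WT : W i j <= T j.
    rewrite /T (big_cat_nat _ (n := i)) ?(ltnW lij)//= [X in _ + X]big_ltn//.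
    by rewrite addrCA lerDl addr_ge0// sumr_ge0.
  have w1 := ramp_ge1 R (Mt j); rewrite -ramp_sqr mulrC => Tr.
  apply: le_trans (_ : T j * 2 ^+ j <= _).
    by rewrite ler_wpM2r ?exprn_ge0.
  by rewrite (le_trans Tr)// expr2 ler_peMl// (le_trans _ w1).
(* The diagonal gain starts at [Mt i]; the missing head of the harmonic sum goes into the
   constant. *)
have HSi N : - (c i * d i * S i N) <=
    2 * Qi + 2 * \sum_(0 <= m < Mt i) m.+1%:R^-1 -
    2 * \sum_(0 <= m < N) m.+1%:R^-1.
  have cd : c i * d i = 4 by rewrite /d; field.
  rewrite cd; have inv0 m : 0 <= m.+1%:R^-1 :> R by rewrite invr_ge0.
  have := sum_head_tail_ge (Mt i) N inv0.
  have [MN|/ltnW NM] := leqP (Mt i) N.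
    have := HQi _ _ (zk i) (fun m => (vr m).1) _ _ MN; rewrite -/(S i N).
    by move: (S i N) => *; lra.
  have E a : \sum_(Mt i <= m < N) a m = 0 :> R by rewrite big_geq.
  by rewrite /S !E => ?; lra.
(* The range of [j] can be extended to [N] before exchanging the sums, because [Mt j <= m] forces j
   <= m. *)
have sumE N : \sum_(0 <= m < N) c i * v m * sin2 (z m i) =
    \sum_(0 <= j < N) - (c i * d j * S j N).
  transitivity (\sum_(0 <= m < N) \sum_(0 <= j < N)
      if (Mt j <= m)%N then
        - (c i * d j * (sin2 (z m i) * sin2 (z m j) / m.+1%:R)) else 0).
    apply: eq_big_nat => m /andP[_ mN].
    rewrite -big_mkcond /v /V (big_nat_widen _ _ _ _ _ mN) /=.
    rewrite mulNr mulrN mulNr mulr_suml mulr_sumr mulr_suml -sumrN.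
    apply: eq_big => [j|j _]; last by ring.
    rewrite ltnS andb_idr// => Mm; exact: leq_trans (HM j).1 Mm.
  rewrite exchange_big_nat/=; apply: eq_bigr => j _.
  rewrite -big_mkcond /S mulr_sumr -sumrN.
  by rewrite [RHS](big_nat_widenl _ 0%N).
have key N : \sum_(0 <= m < N) (c i * v m * sin2 (z m i) + (c i * v m) ^+ 2) <=
  (\sum_(0 <= j < i) W i j + 2 + 2 * Qi + 2 * \sum_(0 <= m < Mt i) m.+1%:R^-1 +
    4 * c i ^+ 2) - 2 * \sum_(0 <= m < N) m.+1%:R^-1.
  rewrite big_split/= sumE.
  have s1 : \sum_(0 <= j < N) - (c i * d j * S j N) <=
      \sum_(0 <= j < N) U j + (2 * Qi + 2 * \sum_(0 <= m < Mt i) m.+1%:R^-1 -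
         2 * \sum_(0 <= m < N) m.+1%:R^-1).
    have U0 j : 0 <= U j.
      by rewrite addr_ge0// ?invr_ge0 ?exprn_ge0//; case: ifP.
    have HU j : j <> i -> - (c i * d j * S j N) <= U j by exact: HS.
    have [iN|Ni] := ltnP i N.
      have iI : i \in index_iota 0 N by rewrite mem_index_iota.
      rewrite [leLHS](bigD1_seq i)//= ?iota_uniq// addrC.
      apply: lerD; last exact: HSi.
      rewrite [leRHS](bigD1_seq i)//= ?iota_uniq//.
      by apply: ler_wpDl => //; apply: ler_sum => j /eqP; exact: HU.
    (* For N <= i the diagonal term is absent; since N <= [Mt i], the sum [S i N] is empty and [HSi]
       says that the remaining expression is nonnegative. *)
    rewrite -[leLHS]addr0; apply: lerD; last first.
      apply: le_trans (HSi N); rewrite /S big_geq ?mulr0 ?oppr0//.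
      exact: leq_trans Ni (HM i).1.
    rewrite !big_mkord ler_sum// => j _; apply: HU => ji.
    by move: (ltn_ord j); rewrite ji ltnNge Ni.
  have s2 : \sum_(0 <= j < N) U j <= \sum_(0 <= j < i) W i j + 2.
    by rewrite big_split/= lerD ?sum_half_pow// sum_below_le.
  have s3 : \sum_(0 <= m < N) (c i * v m) ^+ 2 <= 4 * c i ^+ 2.
    apply: (@le_trans _ _ (c i ^+ 2 * \sum_(0 <= m < N) rho R m)).
      rewrite mulr_sumr ler_sum// => m _; rewrite exprMn ler_wpM2l ?sqr_ge0//.
      exact: (vr m).2.
    by rewrite mulrC ler_wpM2r ?sqr_ge0// sum_rho_le.
  by lra.
move: key; set K := (_ + _ * c i ^+ 2) => key.
exists (nsq (z0 i) * expR K) => [|N]; first by rewrite mulr_ge0 ?expR_ge0 ?ltW.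
apply: le_trans (kicked_le N (zk i)) _.
rewrite -mulrA ler_wpM2l ?(ltW (z00 i))//.
apply: (@le_trans _ _ (expR (K - 2 * \sum_(0 <= m < N) m.+1%:R^-1))).
  by rewrite ler_expR.
rewrite expRD expRN ler_wpM2l ?expR_ge0//.
rewrite lef_pV2 ?posrE ?exprn_gt0 ?expR_gt0//.
rewrite expRM_natl ler_pXn2r ?nnegrE ?expR_ge0//; exact: expR_harmonic.
Qed.

(** * Transfer matrices and quasimomentum *)

Section Transfer.
Variable R : realType.
Implicit Types (a b u w : nat -> R) (E k : R) (q n m : nat).

Lemma mulmx2 (A B : 'M[R]_2) (i j : 'I_2) :
  (A *m B) i j = A i 0 * B 0 j + A i 1 * B 1 j.
Proof.
rewrite mxE !big_ord_recl big_ord0 addr0.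
by rewrite (_ : lift ord0 ord0 = 1)//; exact: val_inj.
Qed.

Lemma transferS0 a b E n j : transfer a b E n.+1 0 j =
  (E - b n.+2) / a n.+2 * transfer a b E n 0 j -
  a n.+1 / a n.+2 * transfer a b E n 1 j.
Proof. by rewrite /= mulmx2 !mxE /= mulNr. Qed.

Lemma transferS1 a b E n j : transfer a b E n.+1 1 j = transfer a b E n 0 j.
Proof. by rewrite /= mulmx2 !mxE /= mul1r mul0r addr0. Qed.

(** The n-th step matrix has determinant [a n / a n.+1], and the product telescopes. *)
Lemma transfer_det a b E n : (forall m, (1 <= m)%N -> a m != 0) ->
  transfer a b E n 0 0 * transfer a b E n 1 1 -
  transfer a b E n 0 1 * transfer a b E n 1 0 = a 1%N / a n.+1.
Proof.
move=> a0; elim: n => [|n IH].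
  by rewrite /= !mxE /= !mulr1 mulr0 subr0 divff// a0.
rewrite !transferS0 !transferS1.
transitivity (a n.+1 / a n.+2 * (a 1%N / a n.+1)); last by field; rewrite !a0.
by rewrite -IH; ring.
Qed.

Lemma discriminantE a b q E :
  discriminant a b q E = transfer a b E q 0 0 + transfer a b E q 1 1.
Proof.
rewrite /discriminant /mxtrace !big_ord_recl big_ord0 addr0.
by rewrite (_ : lift ord0 ord0 = 1)//; exact: val_inj.
Qed.

(** The equation is assumed only up to site [q], so that the lemma also serves sequences solving it
    on a single period. *)
Lemma jacobi_transfer a b E u q : (forall m, (1 <= m)%N -> a m != 0) ->
  (forall n, (1 <= n <= q)%N -> jacobi a b u n = E * u n) ->
  forall n, (n <= q)%N ->
  u n.+1 = transfer a b E n 0 0 * u 1%N + transfer a b E n 0 1 * u 0%N /\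
  u n = transfer a b E n 1 0 * u 1%N + transfer a b E n 1 1 * u 0%N.
Proof.
move=> a0 hu; elim=> [_|n IH nq].
  by rewrite /= !mxE /= !mul1r !mul0r addr0 add0r.
have [IH1 IH2] := IH (ltnW nq); rewrite !transferS0 !transferS1; split=> //.
have := hu n.+1 nq; rewrite /jacobi/= => e.
have -> : u n.+2 = (E - b n.+2) / a n.+2 * u n.+1 - a n.+1 / a n.+2 * u n.
  apply: (mulfI (a0 n.+2 isT)).
  transitivity ((E - b n.+2) * u n.+1 - a n.+1 * u n); last by field; rewrite a0.
  by rewrite mulrBl -e; ring.
by rewrite {}IH1 {}IH2; ring.
Qed.

Lemma solves_unique a b E u w : (forall m, (1 <= m)%N -> a m != 0) ->
  solves a b E u -> solves a b E w -> u 0%N = w 0%N -> u 1%N = w 1%N ->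
  forall n, u n = w n.
Proof.
move=> a0 hu hw e0 e1 n.
have [_ ->] := jacobi_transfer a0 (fun m h => hu m (andP h).1) (leqnn n).
have [_ ->] := jacobi_transfer a0 (fun m h => hw m (andP h).1) (leqnn n).
by rewrite e0 e1.
Qed.

Fixpoint sol_pair a b E (x0 x1 : R) n : R * R :=
  if n is n'.+1 then
    let p := sol_pair a b E x0 x1 n' in
    (p.2, ((E - b n'.+2) * p.2 - a n'.+1 * p.1) / a n'.+2)
  else (x0, x1).

Lemma solution_exists a b E (x0 x1 : R) : (forall m, (1 <= m)%N -> a m != 0) ->
  exists u, [/\ solves a b E u, u 0%N = x0 & u 1%N = x1].
Proof.
move=> a0; exists (fun n => (sol_pair a b E x0 x1 n).1); split=> // -[//|n] _.
by rewrite /jacobi /=; field; rewrite a0.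
Qed.

Lemma solves_lincomb a b E u w (x y : R) :
  solves a b E u -> solves a b E w -> solves a b E (fun n => x * u n + y * w n).
Proof.
move=> hu hw n n1; have := hu n n1; have := hw n n1; rewrite /jacobi => ew eu.
by rewrite [in RHS]mulrDr [E * (x * _)]mulrCA [E * (y * _)]mulrCA -ew -eu; ring.
Qed.

Lemma solves_shift a b E u q : periodic_seq q a -> periodic_seq q b ->
  solves a b E u -> solves a b E (fun n => u (n + q)%N).
Proof.
move=> ha hb hu [//|n] _; have := hu (n.+1 + q)%N isT; rewrite /jacobi.
by rewrite -!addSn ha// ha// hb//= addSn.
Qed.

End Transfer.

Section Quasimomentum.
Variable R : realType.
Implicit Types (a b : nat -> R) (E k : R) (q n m : nat).

Lemma expiD (s t : R) : expi (s + t) = expi s * expi t.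
Proof. by rewrite /expi cosD sinD; congr Complex; rewrite addrC. Qed.

Lemma expi0 : expi 0 = 1 :> R[i].
Proof. by rewrite /expi cos0 sin0. Qed.

Lemma ReM (x y : R[i]) : complex.Re (x * y) =
  complex.Re x * complex.Re y - complex.Im x * complex.Im y.
Proof. by case: x y => [x1 x2] [y1 y2]. Qed.

Lemma ImM (x y : R[i]) : complex.Im (x * y) =
  complex.Re x * complex.Im y + complex.Im x * complex.Re y.
Proof. by case: x y => [x1 x2] [y1 y2]. Qed.

Lemma solves_complex a b E (phi : nat -> R[i]) :
  solves (fun n => real_complex R (a n)) (fun n => real_complex R (b n))
    (real_complex R E) phi <->
  solves a b E (fun n => complex.Re (phi n)) /\
  solves a b E (fun n => complex.Im (phi n)).
Proof.
have H n : (jacobi (fun n => real_complex R (a n))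
    (fun n => real_complex R (b n)) phi n = real_complex R E * phi n) <->
    jacobi a b (fun n => complex.Re (phi n)) n = E * complex.Re (phi n) /\
    jacobi a b (fun n => complex.Im (phi n)) n = E * complex.Im (phi n).
  rewrite /jacobi /=; case: (phi n.+1) (phi n.-1) (phi n) => [x y] [x' y'] [s t].
  split.
    by case => /=; rewrite !mul0r !subr0 !addr0.
  move=> [/= e1 e2].
  by apply/eqP; rewrite eq_complex /= !mul0r !subr0 !addr0 e1 e2 !eqxx.
split=> [h|[h1 h2] n n1]; last by apply/H; split; [exact: h1|exact: h2].
by split=> n n1; have [] := (H n).1 (h n n1).
Qed.

End Quasimomentum.

(* Cayley-Hamilton for [A B; C D]: the hypotheses say that [c + i s] is an
   eigenvalue with eigenvector [(u1, u0) + i (w1, w0)]. *)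
Lemma monodromy_trace (R : comPzRingType) (A B C D c s u0 u1 w0 w1 : R) :
  A * D - B * C = 1 -> c ^+ 2 + s ^+ 2 = 1 ->
  C * u1 + D * u0 = c * u0 - s * w0 -> A * u1 + B * u0 = c * u1 - s * w1 ->
  C * w1 + D * w0 = c * w0 + s * u0 ->
  (A + D - 2 * c) * (c * u0 - s * w0) = 0.
Proof.
move=> det cs e1 e2 e3.
transitivity ((c - A) * (C * u1 + D * u0 - (c * u0 - s * w0)) +
   C * (A * u1 + B * u0 - (c * u1 - s * w1)) -
   s * (C * w1 + D * w0 - (c * w0 + s * u0)) +
   (A * D - B * C - (c ^+ 2 + s ^+ 2)) * u0); first by ring.
by rewrite e1 e2 e3 det cs !subrr !mulr0 mul0r !subr0 !addr0.
Qed.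

(** * The discriminant as twice the cosine of the quasimomentum *)

Section Floquet.
Variable R : realType.
Variables (a b : nat -> R) (q : nat).
Hypotheses (q0 : (1 <= q)%N).
Hypotheses (a_per : periodic_seq q a) (b_per : periodic_seq q b).
Hypothesis a_gt0 : forall n, (1 <= n)%N -> 0 < a n.

Let a_neq0 n : (1 <= n)%N -> a n != 0.
Proof. by move=> n1; rewrite gt_eqF// a_gt0. Qed.

Lemma monodromy_det E :
  transfer a b E q 0 0 * transfer a b E q 1 1 -
  transfer a b E q 0 1 * transfer a b E q 1 0 = 1.
Proof.
rewrite transfer_det// -[q.+1]add1n addnC addnC a_per// divff//.
exact: a_neq0.
Qed.

(** Otherwise the monodromy matrix is triangular with diagonal product 1, and its trace has absolute
    value at least 2. *)
Lemma open_bands_neq0 E : open_bands a b q E -> transfer a b E q 1 0 != 0.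
Proof.
rewrite /open_bands /= discriminantE => Dlt; apply/eqP => C0.
have := monodromy_det E; rewrite C0 mulr0 subr0.
move: (transfer a b E q 0 0) (transfer a b E q 1 1) Dlt => x y + xy.
rewrite ltr_norml => /andP[h1 h2].
by have := sqr_ge0 (x - y); nra.
Qed.

Lemma monodromy E u : solves a b E u ->
  u q.+1 = transfer a b E q 0 0 * u 1%N + transfer a b E q 0 1 * u 0%N /\
  u q = transfer a b E q 1 0 * u 1%N + transfer a b E q 1 1 * u 0%N.
Proof.
by move=> hu; apply: jacobi_transfer (leqnn q) => // n /andP[n1 _]; exact: hu.
Qed.

(** A Floquet solution is an eigenvector of the monodromy matrix for exp(i k). If the trace were not
    2 cos k, [monodromy_trace] would kill both initial values, and uniqueness the whole solution. *)
Lemma is_quasimomentum_discriminant E k :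
  is_quasimomentum a b q E k -> discriminant a b q E = 2 * cos k.
Proof.
move=> [k0pi [phi [/solves_complex[]]]].
set u := fun n => complex.Re (phi n); set w := fun n => complex.Im (phi n).
move=> hu hw [N phiN] [p pq phip].
have q0' : q%:R != 0 :> R by rewrite pnatr_eq0 -lt0n.
have phiq n : phi (n + q)%N = expi k * phi n.
  by rewrite !phip pq mulrCA -expiD natrD mulrDr divfK// addrC.
have [uq1 uq] := monodromy hu; have [wq1 wq] := monodromy hw.
have uE n : u (n + q)%N = cos k * u n - sin k * w n.
  by rewrite /u phiq ReM.
have wE n : w (n + q)%N = cos k * w n + sin k * u n.
  by rewrite /w phiq ImM.
move: (uE 0%N) (uE 1%N) (wE 0%N) (wE 1%N); rewrite add0n add1n uq uq1 wq wq1.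
rewrite discriminantE; have := monodromy_det E.
move: (transfer a b E q 0 0) (transfer a b E q 0 1) (transfer a b E q 1 0)
  (transfer a b E q 1 1) => A B C D det e1 e2 e3 e4.
have cs := cos2Dsin2 k.
apply/eqP; rewrite -subr_eq0; apply/eqP; apply: contra_notP phiN => /eqP ne0.
have cancel (x y : R) : (A + D - 2 * cos k) * (cos k * x - sin k * y) = 0 ->
    (A + D - 2 * cos k) * (cos k * y + sin k * x) = 0 -> x = 0 /\ y = 0.
  move=> /eqP; rewrite mulf_eq0 (negPf ne0) /= => /eqP h1 /eqP.
  rewrite mulf_eq0 (negPf ne0) /= => /eqP h2; split.
    transitivity ((cos k ^+ 2 + sin k ^+ 2) * x); first by rewrite cs mul1r.
    transitivity (cos k * (cos k * x - sin k * y) +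
                  sin k * (cos k * y + sin k * x)).
      by ring.
    by rewrite h1 h2 !mulr0 addr0.
  transitivity ((cos k ^+ 2 + sin k ^+ 2) * y); first by rewrite cs mul1r.
  transitivity (cos k * (cos k * y + sin k * x) -
                sin k * (cos k * x - sin k * y)).
    by ring.
  by rewrite h1 h2 !mulr0 subr0.
have det' : D * A - C * B = 1 by rewrite -det; ring.
have [u00 w00] : u 0%N = 0 /\ w 0%N = 0.
  apply: cancel; first exact: monodromy_trace det cs e1 e2 e3.
  (* The second component is the same identity for the solution multiplied by -i. *)
  have := @monodromy_trace _ A B C D (cos k) (sin k) (w 0%N) (w 1%N)
    (- u 0%N) (- u 1%N) det cs.
  rewrite !mulrN !opprK; apply=> //.
  by rewrite -opprD e1; ring.
have [u10 w10] : u 1%N = 0 /\ w 1%N = 0.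
  (* The values at 1 follow by exchanging the two coordinates, which turns A B C D into D C B A. *)
  rewrite [A + D]addrC in cancel.
  apply: cancel.
    by apply: monodromy_trace det' cs _ _ _; rewrite addrC; eassumption.
  have := @monodromy_trace _ D C B A (cos k) (sin k) (w 1%N) (w 0%N)
    (- u 1%N) (- u 0%N) det' cs.
  rewrite !mulrN !opprK; apply; rewrite addrC//.
  by rewrite -opprD e2; ring.
have h0 : solves a b E (fun=> 0) by move=> n _; rewrite /jacobi !mulr0 !addr0.
apply/eqP; rewrite eq_complex/=; apply/andP; split; apply/eqP.
  exact: (solves_unique a_neq0 hu h0 u00 u10 N).
exact: (solves_unique a_neq0 hw h0 w00 w10 N).
Qed.

Lemma discriminant_is_quasimomentum E k : 0 < k < pi ->
  open_bands a b q E -> discriminant a b q E = 2 * cos k ->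
  is_quasimomentum a b q E k.
Proof.
move=> k0pi /open_bands_neq0 C0; rewrite discriminantE => tr; split=> //.
have q0' : q%:R != 0 :> R by rewrite pnatr_eq0 -lt0n.
have := monodromy_det E.
(* Real and imaginary parts of the solution with phi(0) = 1 and phi(1) = (exp(i k) - D) / C, the
   eigenvector of the monodromy matrix [A B; C D] for exp(i k). *)
have [u [hu u0 u1]] := solution_exists b E 1
  ((cos k - transfer a b E q 1 1) / transfer a b E q 1 0) a_neq0.
have [w [hw w0 w1]] := solution_exists b E 0
  (sin k / transfer a b E q 1 0) a_neq0.
have [uq1 uq] := monodromy hu; have [wq1 wq] := monodromy hw.
move: uq1 uq wq1 wq; rewrite u0 u1 w0 w1.
move: C0 tr u1 w1; move: (transfer a b E q 0 0) (transfer a b E q 0 1)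
  (transfer a b E q 1 0) (transfer a b E q 1 1) => A B C D C0 tr u1 w1.
move=> uq1 uq wq1 wq det.
have AE : A = 2 * cos k - D by rewrite -tr addrK.
have BE : B = (A * D - (cos k ^+ 2 + sin k ^+ 2)) / C.
  by rewrite cos2Dsin2 -det opprB addrC subrK mulfK.
have uE n : u (n + q)%N = cos k * u n + (- sin k) * w n.
  apply: solves_unique (solves_shift a_per b_per hu)
    (solves_lincomb (cos k) (- sin k) hu hw) _ _ n => //=.
    by rewrite add0n uq u0 w0; field.
  by rewrite add1n uq1 u1 w1 BE AE; field.
have wE n : w (n + q)%N = sin k * u n + cos k * w n.
  apply: solves_unique (solves_shift a_per b_per hw)
    (solves_lincomb (sin k) (cos k) hu hw) _ _ n => //=.
    by rewrite add0n wq u0 w0; field.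
  by rewrite add1n wq1 u1 w1 AE; field.
exists (fun n => Complex (u n) (w n)); split.
- by apply/solves_complex.
- by exists 0%N; rewrite u0 w0 => -[/eqP]; rewrite oner_eq0.
exists (fun n => Complex (u n) (w n) * expi (- (k / q%:R * n%:R))) => n.
  have -> : Complex (u (n + q)%N) (w (n + q)%N) = expi k * Complex (u n) (w n).
    apply/eqP; rewrite eq_complex ReM ImM /= uE wE.
    by apply/andP; split; apply/eqP; ring.
  rewrite mulrAC -expiD [LHS]mulrC; congr (_ * expi _).
  by rewrite natrD mulrDr divfK//; ring.
by rewrite -[RHS]mulrA -expiD addNr expi0 mulr1.
Qed.

(** The arccosine of half the discriminant is a witness, so [xget] does not fall back on its
    default; the trace identity then holds for whichever value it picks. *)
Lemma quasimomentumP E : open_bands a b q E ->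
  0 < quasimomentum a b q E < pi /\
  discriminant a b q E = 2 * cos (quasimomentum a b q E).
Proof.
move=> hE; suff qk : is_quasimomentum a b q E (quasimomentum a b q E).
  by split; [case: qk|exact: is_quasimomentum_discriminant].
apply: xgetPex; exists (acos (discriminant a b q E / 2)).
have : -1 < discriminant a b q E / 2 < 1.
  by move: hE; rewrite /open_bands/= ltr_norml => /andP[? ?]; apply/andP; split; lra.
move=> /andP[h1 h2]; apply: discriminant_is_quasimomentum => //.
  by rewrite acos_gt0 ?acos_ltpi ?h1 ?h2 ?(ltW h1) ?(ltW h2).
by rewrite acosK ?in_itv/= ?(ltW h1) ?(ltW h2)//; field.
Qed.

End Floquet.

(** * One kick per period *)

Section PeriodKick.
Variable R : realType.
Variables (a b : nat -> R) (q : nat).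
Hypotheses (q0 : (1 <= q)%N).
Hypotheses (a_per : periodic_seq q a) (b_per : periodic_seq q b).
Hypothesis a_gt0 : forall n, (1 <= n)%N -> 0 < a n.

Let a_neq0 n : (1 <= n)%N -> a n != 0.
Proof. by move=> n1; rewrite gt_eqF// a_gt0. Qed.

(* Coordinates of the state (u 1, u 0) in which the monodromy matrix at energy
   [E], of trace [2 * cos k], is [rotate k]. *)
Definition floquet_coord (E k : R) (x1 x0 : R) : R * R :=
  ((transfer a b E q 1 0 * x1 - (cos k - transfer a b E q 1 1) * x0) / sin k,
   x0).

Lemma floquet_coord_gt0 E k x1 x0 : open_bands a b q E -> sin k != 0 ->
  (x1, x0) <> (0, 0) -> 0 < nsq (floquet_coord E k x1 x0).
Proof.
move=> /(open_bands_neq0 a_per a_gt0) C0 s0 x10; rewrite /nsq/=.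
have [x00|x00] := eqVneq x0 0; last first.
  by rewrite ltr_wpDl ?sqr_ge0// exprn_even_gt0.
rewrite x00 mulr0 subr0 expr0n addr0 exprn_even_gt0//= mulf_neq0 ?invr_eq0//.
by rewrite mulf_neq0//; apply/eqP => x1E; apply: x10; rewrite x1E x00.
Qed.

(** A perturbation at the last site only displaces [w q.+1]. Correcting this one value, as [w']
    does, gives a solution of the unperturbed equation over the period. *)
Lemma kicked_period E (v : R) (w : nat -> R) :
  (forall n, (1 <= n < q)%N -> jacobi a b w n = E * w n) ->
  jacobi a b w q + v * w q = E * w q ->
  w q.+1 = transfer a b E q 0 0 * w 1%N + transfer a b E q 0 1 * w 0%N -
    v / a 1%N * w q /\
  forall n, (n <= q)%N ->
    w n = transfer a b E n 1 0 * w 1%N + transfer a b E n 1 1 * w 0%N.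
Proof.
move=> hw hq; have aq1 : a q.+1 = a 1%N by rewrite -add1n a_per.
pose w' n := if n == q.+1 then w q.+1 + v / a 1%N * w q else w n.
have w'E n : (n <= q)%N -> w' n = w n.
  by move=> nq; rewrite /w' ifN// neq_ltn ltnS nq.
have hw' n : (1 <= n <= q)%N -> jacobi a b w' n = E * w' n.
  move=> /andP[n1 nq]; rewrite /jacobi (w'E n)// (w'E n.-1); last first.
    exact: leq_trans (leq_pred n) nq.
  have [->|nq'] := eqVneq n q; last first.
    have nq1 : (n < q)%N by rewrite ltn_neqAle nq' nq.
    by rewrite w'E//; apply: hw; rewrite n1.
  rewrite /w' eqxx -hq /jacobi aq1; field.
  exact: a_neq0.
have w'0 : w' 0%N = w 0%N by rewrite w'E.
have w'1 : w' 1%N = w 1%N by rewrite w'E.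
split=> [|n nq].
  have [+ _] := jacobi_transfer a_neq0 hw' (leqnn q).
  by rewrite w'0 w'1 /w' eqxx => <-; rewrite addrK.
by have [_] := jacobi_transfer a_neq0 hw' nq; rewrite w'0 w'1 w'E.
Qed.

(** The displacement of [w q.+1] is a multiple of [w q], the second coordinate after the rotation;
    hence a shear. Here the kick follows the rotation, whereas [step] kicks first. *)
Lemma floquet_coord_period E k (v : R) (w : nat -> R) : sin k != 0 ->
  discriminant a b q E = 2 * cos k ->
  (forall n, (1 <= n < q)%N -> jacobi a b w n = E * w n) ->
  jacobi a b w q + v * w q = E * w q ->
  floquet_coord E k (w q.+1) (w q) =
  kick (- transfer a b E q 1 0 / (a 1%N * sin k) * v)
    (rotate k (floquet_coord E k (w 1%N) (w 0%N))).
Proof.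
move=> s0 + hw hq; rewrite discriminantE.
have [-> /(_ q (leqnn q)) ->] := kicked_period hw hq.
have := monodromy_det b a_per a_gt0 E; have := a_neq0 (leqnn 1).
rewrite /floquet_coord /kick /rotate /=.
move: (transfer a b E q 0 0) (transfer a b E q 0 1) (transfer a b E q 1 0)
  (transfer a b E q 1 1) (w 1%N) (w 0%N) (a 1%N) => A B C D x1 x0 a1 a10 det tr.
have AE : A = 2 * cos k - D by rewrite -tr addrK.
have BE : C * B = A * D - (cos k ^+ 2 + sin k ^+ 2).
  by rewrite cos2Dsin2 -det opprB addrC subrK mulrC.
congr (_, _); last by field.
rewrite !mulrBr !mulrDr ![C * (B * _)]mulrA BE AE; field.
by rewrite s0.
Qed.

(** Within the period the values are linear forms in the starting Floquet coordinates with
    coefficients independent of [v]; Cauchy-Schwarz bounds them. *)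
Lemma period_bound E k : open_bands a b q E -> sin k != 0 ->
  exists2 L, 0 <= L & forall (v : R) (w : nat -> R),
    (forall n, (1 <= n < q)%N -> jacobi a b w n = E * w n) ->
    jacobi a b w q + v * w q = E * w q ->
    forall n, (n < q)%N ->
    w n ^+ 2 <= L * nsq (floquet_coord E k (w 1%N) (w 0%N)).
Proof.
move=> /(open_bands_neq0 a_per a_gt0) C0 s0.
pose al n := transfer a b E n 1 0 * sin k / transfer a b E q 1 0.
pose be n := transfer a b E n 1 0 * (cos k - transfer a b E q 1 1) /
  transfer a b E q 1 0 + transfer a b E n 1 1.
have ge0 n : 0 <= al n ^+ 2 + be n ^+ 2 by rewrite addr_ge0 ?sqr_ge0.
exists (\sum_(0 <= n < q) (al n ^+ 2 + be n ^+ 2)); first exact: sumr_ge0.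
move=> v w hw hq n nq.
have -> : w n = al n * (floquet_coord E k (w 1%N) (w 0%N)).1 +
    be n * (floquet_coord E k (w 1%N) (w 0%N)).2.
  have [_ ->] := kicked_period hw hq; last exact: ltnW.
  by rewrite /al /be /=; field; rewrite C0 s0.
case: (floquet_coord _ _ _ _) => x y; rewrite /nsq /=.
apply: (@le_trans _ _ ((al n ^+ 2 + be n ^+ 2) * (x ^+ 2 + y ^+ 2))).
  have := sqr_ge0 (al n * y - be n * x); nra.
rewrite ler_wpM2r ?addr_ge0 ?sqr_ge0// (bigD1_seq n)/= ?iota_uniq//.
  by rewrite lerDl sumr_ge0.
by rewrite mem_index_iota.
Qed.

End PeriodKick.

(** * Assembling the potential and its square-summable solutions *)

Lemma sin_neq0 (R : realType) (k1 k2 : R) : 0 < k1 < pi -> 0 < k2 < pi ->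
  (k1 + k2 <> pi -> sin (k1 + k2) != 0) /\ (k1 <> k2 -> sin (k1 - k2) != 0).
Proof.
move=> /andP[k10 k1p] /andP[k20 k2p]; split=> /eqP h.
  have [lt|gt|e] := ltrgtP (k1 + k2) pi; last by rewrite e eqxx in h.
    by rewrite gt_eqF// sin_gt0_pi// lt addr_gt0.
  have : 0 < sin (k1 + k2 - pi) by rewrite sin_gt0_pi//; apply/andP; split; lra.
  by rewrite sinB cospi sinpi mulr0 subr0 mulrN1 oppr_gt0 => /lt_eqF ->.
have [lt|gt|e] := ltrgtP k1 k2; last by rewrite e eqxx in h.
  by rewrite -opprB sinN oppr_eq0 gt_eqF// sin_gt0_pi//; apply/andP; split; lra.
by rewrite gt_eqF// sin_gt0_pi//; apply/andP; split; lra.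
Qed.

Lemma square_summable_decay (R : realType) (u : nat -> R) (K : R) : 0 <= K ->
  (forall n, u n ^+ 2 <= K / n.+1%:R ^+ 2) -> square_summable u.
Proof.
move=> K0 uK; apply: nondecreasing_is_cvgn.
  by apply/nondecreasing_seqP => n; rewrite seriesSr lerDl sqr_ge0.
exists (K * 4) => _ [N _ <-]; rewrite /series /=.
apply: (@le_trans _ _ (K * \sum_(0 <= n < N) rho R n)); last first.
  by rewrite ler_wpM2l// sum_rho_le.
rewrite mulr_sumr ler_sum// => n _; apply: le_trans (uK n) _.
rewrite ler_wpM2l// /rho lef_pV2 ?posrE ?exprn_gt0 ?mulr_gt0//.
rewrite expr2 ler_wpM2l// -[leRHS](@sqr_sqrtr _ n.+1%:R)// expr2.
by rewrite ler_peMl// sqrtS_ge1.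
Qed.

Lemma periodic_mul (T : Type) (q : nat) (c : nat -> T) (m n : nat) :
  periodic_seq q c -> (1 <= n)%N -> c (n + m * q)%N = c n.
Proof.
move=> cq n1; elim: m => [|m IH]; first by rewrite mul0n addn0.
by rewrite mulSn addnCA addnC cq// addn_gt0 n1.
Qed.

Theorem theorem2p9 (R : realType) (q : nat) (a b : nat -> R)
    (hq : (1 <= q)%N)
    (ha_per : periodic_seq q a) (hb_per : periodic_seq q b)
    (ha_pos : forall n : nat, (1 <= n)%N -> 0 < a n)
    (E : nat -> R)
    (hE : forall j : nat, open_bands a b q (E j))
    (hk_diff : forall i j : nat, i <> j ->
       quasimomentum a b q (E i) <> quasimomentum a b q (E j))
    (hk_pi : forall i j : nat,
       quasimomentum a b q (E i) + quasimomentum a b q (E j) <> pi)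
    (h : nat -> R) (hh_pos : forall n : nat, 0 < h n)
    (hh_lim : h @ \oo --> +oo)
    (theta : nat -> R) (htheta : forall j : nat, 0 <= theta j <= pi) :
  exists b' : nat -> R,
    (forall n : nat, `|b' n| <= h n / (1 + n%:R)) /\
    (forall j : nat, exists u : nat -> R,
       [/\ solves a (fun n => b n + b' n) (E j) u,
           nontrivial u,
           square_summable u &
           boundary_condition (theta j) u]).
Proof.
pose k j := quasimomentum a b q (E j).
have a_neq0 n : (1 <= n)%N -> a n != 0 by move=> n1; rewrite gt_eqF// ha_pos.
have kP j := quasimomentumP hq ha_per hb_per ha_pos (hE j).
have kpi j : 0 < k j < pi by case: (kP j).
have sk j : sin (k j) != 0 by rewrite gt_eqF// sin_gt0_pi.
pose x0 j : R := if theta j == pi / 2 then 0 else 1.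
pose x1 j : R := if theta j == pi / 2 then 1 else tan (theta j).
have x10 j : (x1 j, x0 j) <> (0, 0).
  by rewrite /x1 /x0; case: eqP => _ [] => [|_] /eqP; rewrite oner_eq0.
pose c j := - transfer a b (E j) q 1 0 / (a 1%N * sin (k j)).
(* Orbits are recorded after the rotation of a period and just before its kick, to match the order
   in [step]. *)
pose z0 j := rotate (k j) (floquet_coord a b q (E j) (k j) (x1 j) (x0 j)).
(* [v m] will have index n = (m + 1) q + 1, and 1 + n = (m + 1) q + 2 <= (m + 1) (q + 2). *)
pose H m := h (m.+1 * q).+1 / q.+2%:R.
have [v vH hv] : exists2 v : nat -> R, (forall m, `|v m| <= H m / m.+1%:R) &
    forall j, exists z : nat -> R * R, [/\ z 0%N = z0 j,
      kicked (k j) (c j) v z &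
      exists2 K, 0 <= K & forall m, nsq (z m) <= K / m.+1%:R ^+ 2].
  apply: simultaneous_decay.
  - by move=> i j; apply: (sin_neq0 (kpi i) (kpi j)).1; exact: hk_pi.
  - by move=> i j ij; apply: (sin_neq0 (kpi i) (kpi j)).2; exact: hk_diff.
  - move=> j; rewrite /c mulf_neq0 ?oppr_eq0 ?(open_bands_neq0 ha_per ha_pos)//.
    by rewrite invr_eq0 mulf_neq0// a_neq0.
  - by move=> j; rewrite nsq_rotate floquet_coord_gt0.
  - by move=> m; rewrite divr_gt0.
  apply/cvgryPge => A; have [N _ hN] := (cvgryPge _).1 hh_lim (A * q.+2%:R).
  exists N => // m /= Nm; rewrite ler_pdivlMr//; apply: hN => /=.
  by rewrite (leq_trans Nm)// (leq_trans (leqnSn m))// leqW// leq_pmulr.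
(* The coefficient of index n acts at site n - 1, so the kick ending period m, counted from 0, has
   index (m + 1) q + 1; [q < n] excludes site 0. *)
pose b' n := if (q %| n.-1)%N && (q < n)%N then v (n.-1 %/ q).-1 else 0.
have b'q m : b' (q + m * q).+1 = v m.
  by rewrite /b' -mulSn /= dvdn_mull// mulnK// ltnS mulSn leq_addr.
have b'n m n : (1 <= n < q)%N -> b' (n + m * q).+1 = 0.
  move=> /andP[n1 nq]; rewrite /b' /= dvdn_addl ?dvdn_mull//.
  by rewrite gtnNdvd.
exists b'; split.
  move=> n; rewrite /b'; case: ifPn => [/andP[/dvdnP[d nE] qn]|_]; last first.
    by rewrite normr0 divr_ge0// ?ltW// addr_ge0.
  rewrite nE mulnK//; case: n nE qn => // n /= -> qn.
  case: d qn => [|d] qn; first by rewrite mul0n ltnS leqNgt hq in qn.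
  apply: le_trans (vH d) _; rewrite /H/= -mulrA -invfM.
  rewrite ler_wpM2l ?(ltW (hh_pos _))//.
  rewrite -natrM (_ : 1 + _ = (d.+1 * q).+2%:R) ?nat1r//.
  by rewrite lef_pV2 ?posrE ?ltr0n// ler_nat; nia.
move=> j; have [z [zz0 [z_gt0 zS] [K K0 zK]]] := hv j.
have [u [hu u0 u1]] := solution_exists (fun n => b n + b' n) (E j)
  (x0 j) (x1 j) a_neq0.
exists u.
(* The solution on the m-th period, re-indexed from 0; [w m q] and [w m q.+1] are the initial values
   of the next piece. *)
pose w m n := u (n + m * q)%N.
have hw m n : (1 <= n < q)%N -> jacobi a b (w m) n = E j * w m n.
  move=> nq; have /andP[n1 _] := nq.
  have := hu (n + m * q)%N; rewrite addn_gt0 n1 => /(_ isT) <-.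
  rewrite /jacobi b'n// addr0 -addSn !(periodic_mul m ha_per)//.
  by rewrite !(periodic_mul m hb_per)// /w; case: (n) n1.
have hwq m : jacobi a b (w m) q + v m * w m q = E j * w m q.
  have := hu (q + m * q)%N; rewrite addn_gt0 hq => /(_ isT) <-.
  rewrite /jacobi b'q -addSn !(periodic_mul m ha_per)//.
  rewrite !(periodic_mul m hb_per)// /w.
  by rewrite [in RHS]mulrDl addrA; case: (q) hq.
have zE m : z m = rotate (k j)
    (floquet_coord a b q (E j) (k j) (w m 1%N) (w m 0%N)).
  elim: m => [|m IH]; first by rewrite zz0 /w mul0n !addn0 u0 u1.
  rewrite zS IH /step /c -(floquet_coord_period hq ha_per ha_pos (sk j)
    (kP j).2 (hw m) (hwq m)).
  by rewrite /w.
split=> //.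
- have := x10 j; rewrite -u0 -u1 => un.
  have [u00|/eqP u00] := eqVneq (u 0%N) 0; last by exists 0%N.
  by exists 1%N => u10; apply: un; rewrite u00 u10.
- have [L L0 hL] := period_bound hq ha_per ha_pos (hE j) (sk j).
  (* The factor q^2 passes from periods to sites: with m = n %/ q one has n + 1 <= q (m + 1). *)
  apply: (@square_summable_decay _ _ (L * K * q%:R ^+ 2)).
    by rewrite !mulr_ge0 ?sqr_ge0.
  move=> n; pose m := (n %/ q)%N.
  have -> : u n = w m (n %% q)%N by rewrite /w addnC -divn_eq.
  apply: le_trans (hL _ _ (hw m) (hwq m) _ _) _; first by rewrite ltn_mod.
  rewrite (_ : _ / _ = L * (K * (q%:R ^+ 2 / n.+1%:R ^+ 2)));
    last by rewrite !mulrA.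
  rewrite ler_wpM2l//; move: (zK m); rewrite zE nsq_rotate => /le_trans; apply.
  rewrite ler_wpM2l// -expr_div_n -exprVn ler_pXn2r ?nnegrE ?divr_ge0//.
  rewrite ler_pdivlMr// mulrC ler_pdivrMr// -natrM ler_nat /m.
  by rewrite mulnC ltn_ceil.
split=> [e|/eqP/negPf e]; first by rewrite u0 /x0 e eqxx.
rewrite u0 u1 /x0 /x1 e divr1; split=> //.
by apply/eqP; rewrite oner_eq0.
Qed.
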